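(* (Type $q$-P$(E_3^{(1)};a)$.) Let $$L_1=\frac{\nu_1\nu_2\nu_3\nu_4(g-\frac{\nu_5}{\kappa_2})(g-\frac{\nu_6}{\kappa_2})}{fg}+\frac{\nu_1z}{q}+\frac{\nu_1\nu_2\nu_3(\frac zq-\nu_4)}{f-\frac zq}(g-T_z^{-1})-\frac{\frac{\kappa_1}{\nu_8}(z-\frac{\kappa_1}{\nu_7})}{q(f-z)}\Bigl(T_z-\frac1g\Bigr).$$ Set $f=\nu_4$. Then the equation $L_1y(z)=0$ is written as $$\frac{\kappa_1(z-\frac{\kappa_1}{\nu_7})}{\nu_8}y(qz)+\Bigl(\nu_1z^2+dz+\frac{\kappa_1^2\kappa_2(\nu_5+\nu_6)}{\nu_5\nu_6\nu_7\nu_8}\Bigr)y(z)+q\nu_1\nu_2\nu_3(z-\nu_4)y(z/q)=0,$$ $$d=-\frac{\nu_1\{\nu_2\nu_3(\nu_5+\nu_6)+\kappa_2\nu_4\}}{\kappa_2}+\frac{\kappa_1(\kappa_1-\nu_4\nu_7)}{q\nu_4\nu_7\nu_8}\frac1g .$$ By a gauge transformation, we obtain $$\frac{\kappa_1}{\nu_8}(qz-\nu_4)\Bigl(z-\frac{\kappa_1}{\nu_7}\Bigr)y(qz)+\Bigl(\nu_1z^2+dz+\frac{\kappa_1^2\kappa_2(\nu_5+\nu_6)}{\nu_5\nu_6\nu_7\nu_8}\Bigr)y(z)+q\nu_1\nu_2\nu_3\,y(z/q)=0.$$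
   Context: The parameters $\kappa_1,\kappa_2,\nu_1,\dots,\nu_8$ satisfy $\kappa_1^2\kappa_2^2=q\nu_1\nu_2\cdots\nu_8$. $T_z$ is the $q$-shift operator on the variable $z$: $T_zy(z)=y(qz)$, $T_z^{-1}y(z)=y(z/q)$. $L_1$ is an operator of the Kajiwara–Noumi–Yamada Lax pair for the $q$-Painlevé equation $q$-P$(E_3^{(1)};a)$, whose dependent variables $f,g$ are here treated as parameters. A gauge transformation means multiplying the unknown function by a suitable function; the new unknown function is again denoted by $y$.
   Formalization: The printed d is corrected to d = -ν₁{qν₂ν₃(ν₅+ν₆)+κ₂ν₄}/κ₂ + κ₁(κ₁-ν₄ν₇)/(ν₄ν₇ν₈)·1/g (a factor q added, a factor 1/q removed), and |q|≠1 is assumed, since for |q|=1 no single-valued analytic gauge factor exists. *)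

(* Defs.v *)
From Stdlib Require Import Reals.
From Coquelicot Require Import Coquelicot.

Open Scope C_scope.

Definition qshift (q : C) (y : C -> C) (z : C) : C := y (q * z).
Definition qshift_inv (q : C) (y : C -> C) (z : C) : C := y (z / q).

(* The unknown y is a total function C -> C, but every use of L1 is pointwise
   and only involves y at z, q z and z / q.  The poles of the coefficients,
   where the totalised division of C is meaningless, are z = f and z = q f. *)
Definition L1 (q k1 k2 nu1 nu2 nu3 nu4 nu5 nu6 nu7 nu8 f g : C)
    (y : C -> C) (z : C) : C :=
  nu1 * nu2 * nu3 * nu4 * (g - nu5 / k2) * (g - nu6 / k2) / (f * g) * y z
  + nu1 * z / q * y z
  + nu1 * nu2 * nu3 * (z / q - nu4) / (f - z / q)
      * (g * y z - qshift_inv q y z)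
  - k1 / nu8 * (z - k1 / nu7) / (q * (f - z))
      * (qshift q y z - 1 / g * y z).

(* Coefficient of z y(z) in q (z - nu4) L1 y(z) at f = nu4, simplified with
   k1^2 k2^2 = q nu1 ... nu8.  The source prints nu2 nu3 (nu5 + nu6) without
   the factor q and has an extra 1/q in front of 1/g; neither is compatible
   with L1 and the other coefficients of the equation. *)
Definition accessory_d (q k1 k2 nu1 nu2 nu3 nu4 nu5 nu6 nu7 nu8 g : C) : C :=
  - (nu1 * (q * nu2 * nu3 * (nu5 + nu6) + k2 * nu4) / k2)
  + k1 * (k1 - nu4 * nu7) / (nu4 * nu7 * nu8) * (1 / g).

(* z lies in a q^Z; negative powers are avoided by cross-multiplying. *)
Definition on_qspiral (q a z : C) : Prop :=
  exists m n : nat, q ^ m * z = q ^ n * a.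

(* Main.v *)
(* At f = nu4 the quotient (z/q - nu4) / (f - z/q) is -1, and q (z - nu4) L1 y(z)
   is the first equation once nu8 is eliminated with the parameter relation.

   Multiplying y by h turns the first equation into the second one as soon as
   h(z) = (q z - nu4) h(q z).  For |q| < 1 let P(w) = (w; q)_oo, so that
   P(w) = (1 - w) P(q w); then
     h(z) = P(-z) P(-q/z) / (z P(nu4/z))
   is a solution on C \ {0}, with zeros on the q-spiral of -1 and poles on that
   of nu4.
   P is obtained as the sum of Euler's power series, and its zeros are located
   by iterating the functional equation towards P(0) = 1.  The case |q| > 1
   follows by applying this to 1/q and inverting. *)

Require Import Defs.
From Stdlib Require Import Reals Lra IndefiniteDescription.
From Coquelicot Require Import Coquelicot.
Open Scope C_scope.

Local Arguments Cmod _%_C_scope.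

Local Ltac eq_in_C :=
  lazymatch goal with |- @eq _ ?x ?y => change (@eq C x y) end.

Lemma Copp_neq_0 (z : C) : z <> 0 -> - z <> 0.
Proof.
  intros hz e. apply hz. replace z with (- - z) by ring. rewrite e. ring.
Qed.

Lemma Cinv_neq_0 (z : C) : z <> 0 -> / z <> 0.
Proof.
  intros hz e. apply C1_nz. rewrite <- (Cinv_l z hz), e. ring.
Qed.

(** * Complex differentiability of products, compositions and inverses *)

Local Notation ex_C_derive :=
  (ex_derive (K := C_AbsRing) (V := C_NormedModule)).

(* The structures [C_NormedModule] and [AbsRing_NormedModule C_AbsRing] carry
   the same norm but are not convertible; Coquelicot's product and chain rules
   are stated for the latter. *)
Lemma is_derive_C_AbsRing (f : C -> C) (z l : C) :
  is_derive (K := C_AbsRing) (V := C_NormedModule) f z l <->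
  is_derive (K := C_AbsRing) (V := AbsRing_NormedModule C_AbsRing) f z l.
Proof.
  split; intros [_ h]; (split; [apply is_linear_scal_l | exact h]).
Qed.

Lemma ex_C_derive_mult (f g : C -> C) (z : C) :
  ex_C_derive f z -> ex_C_derive g z -> ex_C_derive (fun x => f x * g x) z.
Proof.
  intros [l hl] [m hm]. apply is_derive_C_AbsRing in hl, hm.
  eexists. apply is_derive_C_AbsRing.
  exact (is_derive_mult (K := C_AbsRing) f g z l m hl hm Cmult_comm).
Qed.

Lemma ex_C_derive_comp (f g : C -> C) (z : C) :
  ex_C_derive f (g z) -> ex_C_derive g z -> ex_C_derive (fun x => f (g x)) z.
Proof.
  intros [l hl] [m hm]. apply is_derive_C_AbsRing in hm.
  eexists. exact (is_derive_comp (K := C_AbsRing) f g z l m hl hm).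
Qed.

(** Reduces differentiability to an explicit estimate: within eps / (|M| + 1) of [z], a remainder
    bounded by M |h|^2 is at most eps |h|. The absolute value makes the radius positive for a bound
    [M] of any sign. *)
Lemma ex_C_derive_quadratic (f : C -> C) (z l : C) (d M : R) :
  (0 < d)%R ->
  (forall h, Cmod h < d ->
     Cmod (f (z + h) - f z - h * l)%C <= M * (Cmod h * Cmod h))%R ->
  ex_C_derive f z.
Proof.
  intros hd hM. exists l. split.
  - apply (is_linear_scal_l (K := C_AbsRing) (V := C_NormedModule)).
  - intros x hx.
    rewrite <- (is_filter_lim_locally_unique
                  (V := AbsRing_NormedModule C_AbsRing) z x hx).
    intros eps.
    assert (hM1 : (0 < Rabs M + 1)%R) by (generalize (Rabs_pos M); lra).
    assert (he : (0 < Rmin d (eps / (Rabs M + 1)))%R).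
    { apply Rmin_glb_lt; [exact hd |].
      apply Rdiv_lt_0_compat; [apply cond_pos | exact hM1]. }
    exists (mkposreal _ he). intros y hy.
    change (Cmod (y - z) < Rmin d (eps / (Rabs M + 1)))%R in hy.
    change (Cmod (f y - f z - (y - z) * l) <= eps * Cmod (y - z))%R.
    replace (f y) with (f (z + (y - z))) by (f_equal; ring).
    eapply Rle_trans.
    { apply hM. eapply Rlt_le_trans; [exact hy | apply Rmin_l]. }
    assert (h2 : (Cmod (y - z) < eps / (Rabs M + 1))%R)
      by (eapply Rlt_le_trans; [exact hy | apply Rmin_r]).
    rewrite <- Rmult_assoc. apply Rmult_le_compat_r; [apply Cmod_ge_0 |].
    apply Rlt_div_r in h2; [| exact hM1].
    generalize (Rle_abs M) (Cmod_ge_0 (y - z)); intros; nra.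
Qed.

(** The first-order remainder is exactly h^2 / (z^2 (z + h)), and |z + h| >= |z| / 2 as long as |h|
    < |z| / 2; hence the constant 2 / |z|^3. *)
Lemma ex_C_derive_inv (z : C) : z <> 0 -> ex_C_derive Cinv z.
Proof.
  intros hz. assert (h0 := Cmod_gt_0 z). apply h0 in hz as hp.
  apply (ex_C_derive_quadratic _ z (- / (z * z)) (Cmod z / 2)
           (2 / (Cmod z * Cmod z * Cmod z))); [lra |].
  intros h hh.
  assert (hlow : (Cmod z / 2 <= Cmod (z + h))%R).
  { generalize (Cmod_triangle (z + h) (- h)). rewrite Cmod_opp.
    replace (z + h + - h) with z by ring. lra. }
  assert (hzh : z + h <> 0) by (apply Cmod_gt_0; lra).
  replace (/ (z + h) - / z - h * - / (z * z)) with (h * h / (z * z * (z + h)))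
    by (field; auto).
  rewrite Cmod_div by (repeat apply Cmult_neq_0; assumption).
  rewrite !Cmod_mult. unfold Rdiv at 1. rewrite Rmult_comm.
  apply Rmult_le_compat_r; [apply Rmult_le_pos; apply Cmod_ge_0 |].
  replace (2 / (Cmod z * Cmod z * Cmod z))%R
    with (/ (Cmod z * Cmod z * (Cmod z / 2)))%R by (field; lra).
  apply Rinv_le_contravar.
  - repeat apply Rmult_lt_0_compat; lra.
  - apply Rmult_le_compat_l; [apply Rmult_le_pos; lra | exact hlow].
Qed.

(** * Taylor remainders of powers and termwise differentiation of entire power series *)

Fixpoint pow_deriv (w : C) (n : nat) : C :=
  match n with O => 0 | S m => w * pow_deriv w m + w ^ m end.

(** [pow_deriv w n] is n w^(n-1), unfolded by the product rule. The crude geometric bound replaces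
    the factor n by a larger radius, which entire coefficients tolerate. *)
Lemma Cmod_pow_deriv_le (w : C) (r : R) (n : nat) :
  (1 <= r)%R -> (Cmod w <= r)%R -> (Cmod (pow_deriv w n) <= (2 * r) ^ n)%R.
Proof.
  intros hr hw. induction n as [|n IH]; simpl.
  - rewrite Cmod_0; lra.
  - eapply Rle_trans; [apply Cmod_triangle |].
    rewrite Cmod_mult, Cmod_pow.
    assert (h1 : (Cmod w ^ n <= (2 * r) ^ n)%R)
      by (apply pow_incr; generalize (Cmod_ge_0 w); lra).
    assert (h2 : (0 <= (2 * r) ^ n)%R) by (apply pow_le; lra).
    assert (h3 : (Cmod w * Cmod (pow_deriv w n) <= r * (2 * r) ^ n)%R)
      by (apply Rmult_le_compat; auto using Cmod_ge_0).
    nra.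
Qed.

(** The remainders R_n satisfy R_(n+1) = (w + h) R_n + h^2 [pow_deriv w n]. Both summands are at
    most r (4r)^n |h|^2, so the radius 4r leaves room for the induction. *)
Lemma Cmod_pow_taylor_le (w h : C) (r : R) (n : nat) :
  (1 <= r)%R -> (Cmod w <= r)%R -> (Cmod (w + h) <= r)%R ->
  (Cmod ((w + h) ^ n - w ^ n - h * pow_deriv w n)
     <= (4 * r) ^ n * (Cmod h * Cmod h))%R.
Proof.
  intros hr hw hwh. induction n as [|n IH].
  - replace ((w + h) ^ 0 - w ^ 0 - h * pow_deriv w 0) with (RtoC 0)
      by (simpl; ring).
    rewrite Cmod_0. generalize (Cmod_ge_0 h); simpl; nra.
  - rewrite !Cpow_S. simpl pow_deriv.
    replace ((w + h) * (w + h) ^ n - w * w ^ n - h * (w * pow_deriv w n + w ^ n))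
      with ((w + h) * ((w + h) ^ n - w ^ n - h * pow_deriv w n)
            + h * h * pow_deriv w n) by ring.
    eapply Rle_trans; [apply Cmod_triangle |]. rewrite !Cmod_mult.
    assert (h1 := Cmod_pow_deriv_le w r n hr hw).
    assert (h2 : ((2 * r) ^ n <= (4 * r) ^ n)%R) by (apply pow_incr; lra).
    assert (h3 : (0 <= Cmod h * Cmod h)%R)
      by (apply Rmult_le_pos; apply Cmod_ge_0).
    assert (h4 : (0 <= (2 * r) ^ n)%R) by (apply pow_le; lra).
    simpl pow.
    set (A := ((4 * r) ^ n)%R) in *. set (B := Cmod (pow_deriv w n)) in *.
    set (H := (Cmod h * Cmod h)%R) in *.
    set (E := Cmod ((w + h) ^ n - w ^ n - h * pow_deriv w n)) in *.
    assert (h5 : (Cmod (w + h) * E <= r * (A * H))%R)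
      by (apply Rmult_le_compat; auto using Cmod_ge_0; apply Cmod_ge_0).
    assert (h6 : (H * B <= H * A)%R) by (apply Rmult_le_compat_l; lra).
    assert (h7 : (0 <= A * H)%R) by (apply Rmult_le_pos; lra).
    nra.
Qed.

Local Notation is_C_series := (is_series (K := C_AbsRing) (V := C_NormedModule)).

Lemma ex_C_series_Cmod (a : nat -> C) :
  ex_series (fun n => Cmod (a n)) -> exists l, is_C_series a l.
Proof.
  intros h.
  destruct (ex_series_le (K := C_AbsRing) (V := C_CompleteNormedModule)
              a (fun n => Cmod (a n))) as [l hl].
  - intros n. apply Rle_refl.
  - exact h.
  - exists l. exact hl.
Qed.

Lemma Cmod_series_le (a : nat -> C) (b : nat -> R) (l : C) (s : R) :
  is_C_series a l -> is_series b s -> (forall n, Cmod (a n) <= b n)%R ->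
  (Cmod l <= s)%R.
Proof.
  intros ha hb hab.
  assert (h1 : is_lim_seq (fun n => Cmod (sum_n (G := C_NormedModule) a n)) (Cmod l)).
  { eapply filterlim_comp; [exact ha |].
    exact (filterlim_norm (K := C_AbsRing) (V := C_NormedModule) l). }
  assert (h2 : is_lim_seq (sum_n b) s) by exact hb.
  refine (is_lim_seq_le _ _ _ _ _ h1 h2).
  intros n. induction n as [|n IH].
  - rewrite !sum_O. apply hab.
  - rewrite !sum_Sn. eapply Rle_trans; [apply Cmod_triangle |].
    apply Rplus_le_compat; [exact IH | apply hab].
Qed.

Lemma is_C_series_unique (a : nat -> C) (l m : C) :
  is_C_series a l -> is_C_series a m -> l = m.
Proof.
  intros hl hm.
  exact (filterlim_locally_unique (V := C_NormedModule) _ l m hl hm).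
Qed.

Definition entire_coeff (a : nat -> C) : Prop :=
  forall r : R, (0 < r)%R -> ex_series (fun n => Cmod (a n) * r ^ n)%R.

Lemma entire_coeff_series (a : nat -> C) (c : nat -> C) (r : R) :
  entire_coeff a -> (0 < r)%R -> (forall n, Cmod (c n) <= r ^ n)%R ->
  exists l, is_C_series (fun n => a n * c n) l.
Proof.
  intros ha hr hc. apply ex_C_series_Cmod.
  apply (ex_series_le (K := R_AbsRing) (V := R_CompleteNormedModule))
    with (fun n => Cmod (a n) * r ^ n)%R.
  - intros n. change (Rabs (Cmod (a n * c n)) <= Cmod (a n) * r ^ n)%R.
    rewrite Rabs_pos_eq, Cmod_mult by apply Cmod_ge_0.
    apply Rmult_le_compat_l; [apply Cmod_ge_0 | apply hc].
  - apply ha, hr.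
Qed.

(** The Taylor remainder of the sum is the sum of the remainders of the terms, dominated by |h|^2
    times the convergent series of |a_n| (4r)^n. *)
Lemma entire_series_ex_derive (a : nat -> C) (P : C -> C) (z : C) :
  entire_coeff a -> (forall w, is_C_series (fun n => a n * w ^ n) (P w)) ->
  ex_C_derive P z.
Proof.
  (* This [r] bounds both |z| and |z + h| for |h| < 1, and is at least 1. *)
  intros ha hP. set (r := (Cmod z + 1)%R).
  assert (hr : (1 <= r)%R) by (unfold r; generalize (Cmod_ge_0 z); lra).
  assert (hzr : (Cmod z <= r)%R) by (unfold r; lra).
  destruct (entire_coeff_series a (pow_deriv z) (2 * r)) as [l hl].
  { exact ha. } { lra. } { intros n. apply Cmod_pow_deriv_le; assumption. }
  destruct (ha (4 * r)%R) as [M hM]; [lra |].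
  apply (ex_C_derive_quadratic P z l 1 M); [lra |].
  intros h hh.
  assert (hzh : (Cmod (z + h) <= r)%R).
  { eapply Rle_trans; [apply Cmod_triangle | unfold r; lra]. }
  apply (Cmod_series_le
    (fun n => a n * (z + h) ^ n - a n * z ^ n - h * (a n * pow_deriv z n))
    (fun n => Cmod (a n) * (4 * r) ^ n * (Cmod h * Cmod h))%R).
  - apply (is_series_minus (K := C_AbsRing) (V := C_NormedModule)
             (fun n => a n * (z + h) ^ n - a n * z ^ n)
             (fun n => h * (a n * pow_deriv z n))).
    + apply (is_series_minus (K := C_AbsRing) (V := C_NormedModule)
             (fun n => a n * (z + h) ^ n) (fun n => a n * z ^ n)); apply hP.
    + apply (is_series_scal (K := C_AbsRing) (V := C_NormedModule) h), hl.
  - apply is_series_scal_r, hM.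
  - intros n.
    replace (a n * (z + h) ^ n - a n * z ^ n - h * (a n * pow_deriv z n))
      with (a n * ((z + h) ^ n - z ^ n - h * pow_deriv z n)) by ring.
    rewrite Cmod_mult, Rmult_assoc.
    apply Rmult_le_compat_l; [apply Cmod_ge_0 |].
    apply Cmod_pow_taylor_le; assumption.
Qed.

(** * The q-Pochhammer symbol as an entire function, and its zeros *)

Lemma Cpow_neq_1 (q : C) (n : nat) : (Cmod q < 1)%R -> 1 - q ^ S n <> 0.
Proof.
  intros hq e.
  assert (h : Cmod (q ^ S n) = 1%R).
  { replace (q ^ S n) with (1 - (1 - q ^ S n)) by ring. rewrite e.
    replace (1 - 0) with (RtoC 1) by ring. apply Cmod_1. }
  rewrite Cmod_pow in h.
  assert (h1 := pow_lt_1_compat (Cmod q) (S n) (conj (Cmod_ge_0 q) hq) (Nat.lt_0_succ n)).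
  lra.
Qed.

(* Euler's expansion of the q-Pochhammer symbol (w; q)_oo. *)
Fixpoint euler_coeff (q : C) (n : nat) : C :=
  match n with
  | O => 1
  | S m => - q ^ m * euler_coeff q m / (1 - q ^ S m)
  end.

Lemma euler_coeff_S (q : C) (n : nat) :
  euler_coeff q (S n) = - q ^ n * euler_coeff q n / (1 - q ^ S n).
Proof. reflexivity. Qed.

Lemma euler_coeff_neq_0 (q : C) (n : nat) :
  q <> 0 -> (Cmod q < 1)%R -> euler_coeff q n <> 0.
Proof.
  intros h0 hq. induction n as [|n IH].
  - apply C1_nz.
  - rewrite euler_coeff_S. apply Cmult_neq_0.
    + apply Cmult_neq_0; [| exact IH]. apply Copp_neq_0, Cpow_nz, h0.
    + apply Cinv_neq_0, Cpow_neq_1, hq.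
Qed.

(** Ratio test: consecutive terms have ratio r |q|^n / |1 - q^(n+1)|, and |1 - q^(n+1)| >= 1 - |q|
    gives a geometric majorant, so the limit is 0 for every r. *)
Lemma euler_coeff_entire (q : C) :
  q <> 0 -> (Cmod q < 1)%R -> entire_coeff (euler_coeff q).
Proof.
  intros h0 hq r hr.
  assert (hpos : forall n, (0 < Cmod (euler_coeff q n) * r ^ n)%R).
  { intros n. apply Rmult_lt_0_compat; [| apply pow_lt, hr].
    apply Cmod_gt_0, euler_coeff_neq_0; assumption. }
  apply ex_series_ext with (fun n => Rabs (Cmod (euler_coeff q n) * r ^ n)).
  { intros n. apply Rabs_pos_eq, Rlt_le, hpos. }
  apply ex_series_DAlembert with 0%R; [lra | |].
  { intros n. apply Rgt_not_eq, hpos. }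
  apply (is_lim_seq_le_le (fun _ => 0%R) _
           (fun n => r / (1 - Cmod q) * Cmod q ^ n)%R).
  - intros n. split; [apply Rabs_pos |].
    assert (h1 := Cpow_neq_1 q n hq).
    assert (h2 : (1 - Cmod q <= Cmod (1 - q ^ S n))%R).
    { assert (h3 := Cmod_triangle (1 - q ^ S n) (q ^ S n)).
      replace (1 - q ^ S n + q ^ S n) with (RtoC 1) in h3 by ring.
      rewrite Cmod_1, Cmod_pow in h3. simpl pow in h3.
      assert (h4 : (Cmod q ^ n <= 1)%R).
      { rewrite <- (pow1 n). apply pow_incr. split; [apply Cmod_ge_0 | lra]. }
      assert (h5 := Rmult_le_compat_l _ _ _ (Cmod_ge_0 q) h4). lra. }
    rewrite euler_coeff_S. rewrite Cmod_div, !Cmod_mult, Cmod_opp, Cmod_pow by exact h1.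
    rewrite Rabs_pos_eq.
    2:{ apply Rlt_le, Rdiv_lt_0_compat; [| apply hpos].
        specialize (hpos (S n)). rewrite euler_coeff_S in hpos.
        rewrite Cmod_div, !Cmod_mult, Cmod_opp, Cmod_pow in hpos by exact h1.
        exact hpos. }
    specialize (hpos n).
    assert (h6 : (0 < Cmod (euler_coeff q n))%R)
      by (apply Cmod_gt_0, euler_coeff_neq_0; assumption).
    assert (h7 : (0 < r ^ n)%R) by (apply pow_lt, hr).
    replace (Cmod q ^ n * Cmod (euler_coeff q n) / Cmod (1 - q ^ S n) * r ^ S n
               / (Cmod (euler_coeff q n) * r ^ n))%R
      with (/ Cmod (1 - q ^ S n) * (r * Cmod q ^ n))%R
      by (simpl pow; field; lra).
    replace (r / (1 - Cmod q) * Cmod q ^ n)%R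
      with (/ (1 - Cmod q) * (r * Cmod q ^ n))%R by (field; lra).
    apply Rmult_le_compat_r.
    + apply Rmult_le_pos; [lra | apply pow_le, Cmod_ge_0].
    + apply Rinv_le_contravar; lra.
  - apply is_lim_seq_const.
  - replace (Finite 0) with (Rbar_mult (r / (1 - Cmod q))%R 0)
      by (simpl; f_equal; ring).
    apply is_lim_seq_scal_l, is_lim_seq_geom.
    rewrite Rabs_pos_eq; [exact hq | apply Cmod_ge_0].
Qed.

(** The functional equation amounts to the recurrence (1 - q^(n+1)) a_(n+1) = - q^n a_n on the Euler
    coefficients. *)
Lemma q_pochhammer_exists (q : C) :
  q <> 0 -> (Cmod q < 1)%R ->
  exists P : C -> C,
    (forall w : C, ex_C_derive P w) /\ P 0 = 1
    /\ (forall w, P w = (1 - w) * P (q * w)).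
Proof.
  intros h0 hq.
  assert (ha := euler_coeff_entire q h0 hq).
  destruct (functional_choice
    (fun w l : C => is_C_series (fun n => euler_coeff q n * w ^ n) l)) as [P hP].
  { intros w. apply entire_coeff_series with (Cmod w + 1)%R; [exact ha | |].
    - generalize (Cmod_ge_0 w); lra.
    - intros n. rewrite Cmod_pow. apply pow_incr.
      generalize (Cmod_ge_0 w); lra. }
  exists P. split; [| split].
  - intros w. apply entire_series_ex_derive with (euler_coeff q); assumption.
  - apply (is_C_series_unique (fun n => euler_coeff q n * 0 ^ n)); [apply hP |].
    apply is_series_decr_1.
    (* Past the constant term the series at 0 vanishes termwise; writing it as 0 times the
       convergent series at 1 gives its sum. *)
    apply (is_series_ext (K := C_AbsRing) (V := C_NormedModule)
             (fun n => 0 * (euler_coeff q n * 1 ^ n))).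
    { intros n. rewrite Cpow_S. eq_in_C. ring. }
    replace (plus _ _) with (0 * P 1)
      by (change (0 * P 1 = 1 + - (1 * 1)); ring).
    apply (is_series_scal (K := C_AbsRing) (V := C_NormedModule) (RtoC 0)), hP.
  - intros w.
    apply (is_C_series_unique (fun n => euler_coeff q n * w ^ n)); [apply hP |].
    (* The coefficient of w^(n+1) in (1 - w) P(q w) is a_{n+1} q^{n+1} - a_n q^n. *)
    apply is_series_decr_1.
    apply (is_series_ext (K := C_AbsRing) (V := C_NormedModule)
             (fun n => euler_coeff q (S n) * (q * w) ^ S n
                       - w * (euler_coeff q n * (q * w) ^ n))).
    { intros n. eq_in_C.
      rewrite !Cpow_mult_l, !Cpow_S. rewrite euler_coeff_S, Cpow_S.
      field. rewrite <- Cpow_S. apply Cpow_neq_1, hq. }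
    replace (plus _ _) with (P (q * w) - 1 - w * P (q * w))
      by (change (P (q * w) - 1 - w * P (q * w)
                  = (1 - w) * P (q * w) + - (1 * 1)); ring).
    apply (is_series_minus (K := C_AbsRing) (V := C_NormedModule)).
    + apply (is_series_incr_1 (K := C_AbsRing) (V := C_NormedModule)
               (fun n => euler_coeff q n * (q * w) ^ n)).
      replace (plus _ _) with (P (q * w))
        by (change (P (q * w) = P (q * w) - 1 + 1 * 1); ring).
      apply hP.
    + apply (is_series_scal (K := C_AbsRing) (V := C_NormedModule) w), hP.
Qed.

Lemma q_pochhammer_neq_0 (q : C) (P : C -> C) (w : C) :
  (Cmod q < 1)%R -> ex_C_derive P (RtoC 0) -> P 0 = 1 ->
  (forall w, P w = (1 - w) * P (q * w)) ->
  (forall n : nat, q ^ n * w <> 1) -> P w <> 0.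
Proof.
  intros hq hd hP0 hP hw e.
  (* No factor 1 - q^n w vanishes, so a zero at [w] propagates to every q^n w. These points tend to
     0, where P is continuous with value 1. *)
  assert (hn : forall n, P (q ^ n * w) = 0).
  { induction n as [|n IH].
    - rewrite <- e. f_equal. simpl. ring.
    - rewrite hP in IH.
      replace (q ^ S n * w) with (q * (q ^ n * w)) by (rewrite Cpow_S; ring).
      assert (h1 : 1 - q ^ n * w <> 0).
      { intros h. apply (hw n).
        replace (q ^ n * w) with (1 - (1 - q ^ n * w)) by ring.
        rewrite h. ring. }
      replace (P (q * (q ^ n * w)))
        with (/ (1 - q ^ n * w) * ((1 - q ^ n * w) * P (q * (q ^ n * w))))
        by (field; exact h1).
      rewrite IH. ring. }
  apply ex_derive_continuous in hd.
  destruct (hd (ball (P 0) (mkposreal 1 Rlt_0_1)) (locally_ball _ _)) as [d h].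
  destruct (pow_lt_1_zero (Cmod q)) with (d / (Cmod w + 1))%R as [N hN].
  - rewrite Rabs_pos_eq; [exact hq | apply Cmod_ge_0].
  - apply Rdiv_lt_0_compat; [apply cond_pos |].
    generalize (Cmod_ge_0 w); lra.
  - specialize (hN N (Nat.le_refl N)).
    specialize (h (q ^ N * w)). rewrite hn, hP0 in h.
    assert (hb : (Cmod (q ^ N * w - 0) < d)%R).
    { replace (q ^ N * w - 0) with (q ^ N * w) by ring.
      rewrite Cmod_mult, Cmod_pow.
      rewrite Rabs_pos_eq in hN by (apply pow_le, Cmod_ge_0).
      apply Rlt_div_r in hN; [| generalize (Cmod_ge_0 w); lra].
      assert (h2 := pow_le _ N (Cmod_ge_0 q)). nra. }
    (* Balls in the target are componentwise; the real parts 0 and 1 already contradict radius 1. *)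
    destruct (h hb) as [h1 _]. change (Rabs (0 - 1) < 1)%R in h1.
    rewrite Rabs_left in h1; lra.
Qed.

(** * Solving h(z) = (q z - a) h(q z) *)

Lemma q_difference_solution_inside (q a : C) :
  q <> 0 -> (Cmod q < 1)%R ->
  exists h : C -> C, forall z : C, z <> 0 ->
    ~ on_qspiral q a z -> ~ on_qspiral q (-1) z ->
    ex_C_derive h z /\ h z <> 0 /\ h z = (q * z - a) * h (q * z).
Proof.
  intros h0 hq.
  destruct (q_pochhammer_exists q h0 hq) as [P [hd [hP0 hP]]].
  assert (hnz := fun w => q_pochhammer_neq_0 q P w hq (hd (RtoC 0)) hP0 hP).
  (* Under z -> q z the theta product P(-z) P(-q/z) gains 1/z, the factor 1/P(a/z) gains q z / (q z
     - a), and 1/z gains 1/q; together 1 / (q z - a). *)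
  exists (fun z => P (- z) * P (- q / z) * / (z * P (a / z))).
  intros z hz ha hb.
  assert (n1 : P (- z) <> 0).
  { apply hnz. intros n e. apply hb. exists n, 0%nat.
    replace (q ^ n * z) with (- (q ^ n * - z)) by ring. rewrite e. simpl. ring. }
  assert (n2 : P (- q / z) <> 0).
  { apply hnz. intros n e. apply hb. exists 0%nat, (S n).
    replace (q ^ S n * -1) with (q ^ n * (- q / z) * z)
      by (rewrite Cpow_S; field; exact hz).
    rewrite e. simpl. ring. }
  assert (n3 : P (a / z) <> 0).
  { apply hnz. intros n e. apply ha. exists 0%nat, n.
    replace (q ^ n * a) with (q ^ n * (a / z) * z) by (field; exact hz).
    rewrite e. simpl. ring. }
  split; [| split].
  - assert (dinv : forall c, ex_C_derive (fun x => P (c / x)) z).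
    { intros c. apply (ex_C_derive_comp P); [apply hd |].
      apply ex_C_derive_mult; [| apply ex_C_derive_inv, hz].
      eexists; apply is_derive_const. }
    assert (did : ex_C_derive (fun x => x) z)
      by (eexists; apply is_derive_C_AbsRing, is_derive_id).
    apply (ex_C_derive_mult (fun x => P (- x) * P (- q / x))
             (fun x => / (x * P (a / x)))).
    + apply (ex_C_derive_mult (fun x => P (- x))); [| apply dinv].
      apply (ex_C_derive_comp P); [apply hd |].
      apply (ex_derive_opp (K := C_AbsRing) (V := C_NormedModule)), did.
    + apply (ex_C_derive_comp Cinv (fun x => x * P (a / x))).
      * apply ex_C_derive_inv, Cmult_neq_0; assumption.
      * apply (ex_C_derive_mult (fun x => x)); [exact did | apply dinv].
  - repeat apply Cmult_neq_0; try assumption.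
    apply Cinv_neq_0, Cmult_neq_0; assumption.
  (* The point a/q lies on the q-spiral of [a], hence is excluded. *)
  - assert (hqz : q * z - a <> 0).
    { intros e. apply ha. exists 1%nat, 0%nat. simpl.
      replace (q * 1 * z) with (q * z - a + a) by ring. rewrite e. ring. }
    assert (e1 := hP (- z)). assert (e2 := hP (- q / (q * z))).
    assert (e3 := hP (a / (q * z))).
    replace (q * - z) with (- (q * z)) in e1 by ring.
    replace (q * (- q / (q * z))) with (- q / z) in e2 by (field; auto).
    replace (q * (a / (q * z))) with (a / z) in e3 by (field; auto).
    rewrite e1, e2, e3. field. repeat split; auto.
Qed.

Lemma on_qspiral_inv (q a z : C) :
  q <> 0 -> on_qspiral (/ q) a z -> on_qspiral q a z.
Proof.
  intros h0 [m [n e]]. exists n, m.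
  rewrite !Cpow_inv in e by exact h0.
  assert (hm := Cpow_nz q m h0). assert (hn := Cpow_nz q n h0).
  replace (q ^ n * z) with (q ^ n * q ^ m * (/ q ^ m * z)) by (field; exact hm).
  rewrite e. field. exact hn.
Qed.

Lemma on_qspiral_mul (q a z : C) : on_qspiral q a (q * z) -> on_qspiral q a z.
Proof.
  intros [m [n e]]. exists (S m), n. rewrite <- e, Cpow_S. ring.
Qed.

Lemma on_qspiral_div (q a z : C) :
  q <> 0 -> on_qspiral q a (z / q) -> on_qspiral q a z.
Proof.
  intros h0 [m [n e]]. exists m, (S n).
  rewrite Cpow_S, <- Cmult_assoc, <- e. field. exact h0.
Qed.

Lemma q_difference_solution (q a : C) :
  q <> 0 -> Cmod q <> 1%R ->
  exists h : C -> C, forall z : C, z <> 0 ->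
    ~ on_qspiral q a z -> ~ on_qspiral q (-1) z ->
    ex_C_derive h z /\ h z <> 0 /\ h z = (q * z - a) * h (q * z).
Proof.
  intros h0 hq1.
  destruct (Rlt_le_dec (Cmod q) 1) as [hq | hq].
  { apply q_difference_solution_inside; assumption. }
  assert (hp : (Cmod (/ q) < 1)%R).
  { rewrite Cmod_inv by exact h0. rewrite <- Rinv_1.
    apply Rinv_lt_contravar; lra. }
  destruct (q_difference_solution_inside (/ q) a (Cinv_neq_0 q h0) hp) as [m hm].
  (* The equation for [m] with base 1/q, taken at q^2 z, reads m(q^2 z) = (q z - a) m(q z);
     inverting it gives the equation for h. *)
  exists (fun z => / m (q * z)). intros z hz ha hb.
  assert (hmul : forall b w, ~ on_qspiral q b w -> ~ on_qspiral q b (q * w))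
    by (intros b w hbw hbw'; apply hbw, on_qspiral_mul, hbw').
  assert (hinv : forall b w, ~ on_qspiral q b w -> ~ on_qspiral (/ q) b w)
    by (intros b w hbw hbw'; apply hbw, on_qspiral_inv; assumption).
  destruct (hm (q * z)) as [d1 [n1 _]]; auto using Cmult_neq_0.
  destruct (hm (q * (q * z))) as [_ [n2 e2]]; auto 6 using Cmult_neq_0.
  replace (/ q * (q * (q * z))) with (q * z) in e2 by (field; exact h0).
  split; [| split].
  - apply (ex_C_derive_comp Cinv (fun x => m (q * x))).
    + apply ex_C_derive_inv, n1.
    + apply (ex_C_derive_comp m (fun x => q * x)); [exact d1 |].
      apply (ex_C_derive_mult (fun _ => q) (fun x => x)).
      * eexists; apply is_derive_const.
      * eexists; apply is_derive_C_AbsRing, is_derive_id.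
  - apply Cinv_neq_0, n1.
  - rewrite e2 in n2 |- *. field. split; [exact n1 |].
    intros e. apply n2. rewrite e. ring.
Qed.

(** * The equation at f = nu4 and its gauge transform *)

Lemma L1_specialized (q k1 k2 nu1 nu2 nu3 nu4 nu5 nu6 nu7 nu8 g : C)
    (y : C -> C) (z : C) :
  q <> 0 -> k1 <> 0 -> k2 <> 0 ->
  nu1 <> 0 -> nu2 <> 0 -> nu3 <> 0 -> nu4 <> 0 ->
  nu5 <> 0 -> nu6 <> 0 -> nu7 <> 0 -> nu8 <> 0 -> g <> 0 ->
  k1 ^ 2 * k2 ^ 2 = q * (nu1 * nu2 * nu3 * nu4 * nu5 * nu6 * nu7 * nu8) ->
  z <> nu4 -> z <> q * nu4 ->
  k1 * (z - k1 / nu7) / nu8 * y (q * z)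
  + (nu1 * z ^ 2
     + accessory_d q k1 k2 nu1 nu2 nu3 nu4 nu5 nu6 nu7 nu8 g * z
     + k1 ^ 2 * k2 * (nu5 + nu6) / (nu5 * nu6 * nu7 * nu8)) * y z
  + q * nu1 * nu2 * nu3 * (z - nu4) * y (z / q)
  = q * (z - nu4) * L1 q k1 k2 nu1 nu2 nu3 nu4 nu5 nu6 nu7 nu8 nu4 g y z.
Proof.
  intros hq hk1 hk2 hnu1 hnu2 hnu3 hnu4 hnu5 hnu6 hnu7 hnu8 hg hrel hz hqz.
  assert (h1 : nu4 - z <> 0).
  { intros e; apply hz. replace z with (nu4 - (nu4 - z)) by ring.
    rewrite e; ring. }
  assert (h2 : nu4 * q - z <> 0).
  { intros e; apply hqz. replace z with (nu4 * q - (nu4 * q - z)) by ring.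
    rewrite e; ring. }
  (* In the coefficient of y(z) the terms linear in [g] cancel outright, whereas the 1/g part of its
     constant term cancels only through the parameter relation. *)
  assert (e8 : nu8 = k1 ^ 2 * k2 ^ 2
                     / (q * nu1 * nu2 * nu3 * nu4 * nu5 * nu6 * nu7))
    by (rewrite hrel; field; repeat split; assumption).
  unfold L1, accessory_d, qshift, qshift_inv.
  generalize (y (q * z)) (y z) (y (z / q)); intros Y1 Y0 Y2.
  rewrite e8; field. repeat split; try assumption.
  all: intros e; apply h1; rewrite <- e; ring.
Qed.

Lemma Cmult_eq_0_iff (a b : C) : a <> 0 -> (b = 0 <-> a * b = 0).
Proof.
  intros ha. split; intros e.
  - rewrite e. ring.
  - replace b with (/ a * (a * b)) by (field; exact ha). rewrite e. ring.
Qed.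

Theorem mainTheorem11
  (q k1 k2 nu1 nu2 nu3 nu4 nu5 nu6 nu7 nu8 g : C)
  (hq0 : q <> 0) (hq1 : Cmod q <> 1%R)
  (hk1 : k1 <> 0) (hk2 : k2 <> 0)
  (hnu1 : nu1 <> 0) (hnu2 : nu2 <> 0) (hnu3 : nu3 <> 0) (hnu4 : nu4 <> 0)
  (hnu5 : nu5 <> 0) (hnu6 : nu6 <> 0) (hnu7 : nu7 <> 0) (hnu8 : nu8 <> 0)
  (hg : g <> 0)
  (hrel : k1 ^ 2 * k2 ^ 2 = q * (nu1 * nu2 * nu3 * nu4 * nu5 * nu6 * nu7 * nu8)) :
  let d := accessory_d q k1 k2 nu1 nu2 nu3 nu4 nu5 nu6 nu7 nu8 g in
  let c := k1 ^ 2 * k2 * (nu5 + nu6) / (nu5 * nu6 * nu7 * nu8) in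
  let lhs1 := fun (y : C -> C) (z : C) =>
    k1 * (z - k1 / nu7) / nu8 * y (q * z)
    + (nu1 * z ^ 2 + d * z + c) * y z
    + q * nu1 * nu2 * nu3 * (z - nu4) * y (z / q) in
  let lhs2 := fun (y : C -> C) (z : C) =>
    k1 / nu8 * (q * z - nu4) * (z - k1 / nu7) * y (q * z)
    + (nu1 * z ^ 2 + d * z + c) * y z
    + q * nu1 * nu2 * nu3 * y (z / q) in
  (forall (y : C -> C) (z : C), z <> nu4 -> z <> q * nu4 ->
     (L1 q k1 k2 nu1 nu2 nu3 nu4 nu5 nu6 nu7 nu8 nu4 g y z = 0
      <-> lhs1 y z = 0))
  /\
  (exists (h : C -> C) (b : C),
     forall z : C, z <> 0 -> ~ on_qspiral q nu4 z -> ~ on_qspiral q b z ->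
       ex_derive (K := C_AbsRing) (V := C_NormedModule) h z
       /\ h z <> 0
       /\ (forall y : C -> C,
             lhs1 y z = 0 <-> lhs2 (fun x => h x * y x) z = 0)).
Proof.
  intros d c lhs1 lhs2. split.
  - intros y z hz hqz. unfold lhs1, d, c.
    rewrite L1_specialized by assumption.
    apply Cmult_eq_0_iff, Cmult_neq_0; [exact hq0 |].
    intros e. apply hz. replace z with (z - nu4 + nu4) by ring. rewrite e. ring.
  - destruct (q_difference_solution q nu4 hq0 hq1) as [h hh].
    (* The theta product in [h] vanishes on the q-spiral of -1, hence b = -1. *)
    exists h, (-1). intros z hz ha hb.
    destruct (hh z hz ha hb) as [hd [hn he]].
    split; [exact hd | split; [exact hn |]].
    (* The functional equation is used twice: at [z] it absorbs q z - nu4 from the y(q z) term, and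
       at z/q it produces z - nu4 in the y(z/q) term. Thus [lhs2] of h y equals h(z) times [lhs1] of
       y. *)
    destruct (hh (z / q)) as [_ [_ he']].
    { apply Cmult_neq_0; [exact hz | apply Cinv_neq_0, hq0]. }
    { intros hs. apply ha, (on_qspiral_div q); assumption. }
    { intros hs. apply hb, (on_qspiral_div q); assumption. }
    replace (q * (z / q)) with z in he' by (field; exact hq0).
    intros y. rewrite (Cmult_eq_0_iff (h z) (lhs1 y z) hn).
    replace (lhs2 (fun x => h x * y x) z) with (h z * lhs1 y z); [tauto |].
    unfold lhs1, lhs2. rewrite he', he. unfold Cdiv. ring.
Qed.
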